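(* Let $\mathcal{G}_{A,A'}$ be the stochastic masking game graph for PTSs $A$ and $A'$, and let $\mathcal{SG}_{A,A'}$ be the corresponding symbolic game graph. Then the Verifier has a sure (or almost-sure) winning strategy in $\mathcal{G}_{A,A'}$ for the objective $\neg\Diamond v_{\text{err}}$ (never reach $v_{\text{err}}$) if and only if $v_0^{\mathcal{SG}} \notin U$.
   Context: A probabilistic transition system (PTS) is $A=(S,\Sigma,\rightarrow,s_0)$ with finite state set $S$, finite action set $\Sigma$, finite transition relation $\rightarrow\subseteq S\times\Sigma\times\mathcal{D}(S)$ (where $\mathcal{D}(S)$ is the set of probability distributions on $S$), initial state $s_0$, and every state having at least one outgoing transition. The nominal model is $A=(S,\Sigma,\rightarrow,s_0)$ and the implementation is $A'=(S',\Sigma\cup\mathcal{F},\rightarrow',s'_0)$, where $\mathcal{F}$ is a finite set of fault labels with $\mathcal{F}\cap\Sigma=\emptyset$. $\Delta_s$ is the Dirac distribution on $s$, $\mathrm{Supp}(\mu)=\{s\mid\mu(s)>0\}$. A coupling for $(\mu,\mu')$ is $w\in\mathcal{D}(S\times S')$ with $w(\cdot,S')=\mu$ and $w(S,\cdot)=\mu'$; the set of couplings is denoted $\mathrm{Couplings}(\mu,\mu')$. The stochastic masking game graph $\mathcal{G}_{A,A'}$ is played between the Refuter and the Verifier. Refuter vertices: $(s,-,s',-,-,-,\mathsf{R})$ for $s\in S,s'\in S'$, plus an error vertex $v_{\text{err}}$. Verifier vertices: $(s,\sigma^1,s',\mu,-,-,\mathsf{V})$ with $\sigma\in\Sigma$,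 $s\xrightarrow{\sigma}\mu$; and $(s,\sigma^2,s',-,\mu',-,\mathsf{V})$ with $\sigma\in\Sigma\cup\mathcal{F}$, $s'\xrightarrow{\sigma}{}'\mu'$. Probabilistic vertices: $(s,-,s',\mu,\mu',w,\mathsf{P})$ with $w\in\mathrm{Couplings}(\mu,\mu')$ and some $\sigma\in\Sigma\cup\mathcal{F}$ with ($s\xrightarrow{\sigma}\mu$ or ($\sigma\in\mathcal{F}$ and $\mu=\Delta_s$)) and $s'\xrightarrow{\sigma}{}'\mu'$. Initial vertex $(s_0,-,s'_0,-,-,-,\mathsf{R})$. Edges: from $(s,-,s',-,-,-,\mathsf{R})$ to $(s,\sigma^1,s',\mu,-,-,\mathsf{V})$ if $s\xrightarrow{\sigma}\mu$, and to $(s,\sigma^2,s',-,\mu',-,\mathsf{V})$ if $s'\xrightarrow{\sigma}{}'\mu'$; from $(s,\sigma^1,s',\mu,-,-,\mathsf{V})$ to $(s,-,s',\mu,\mu',w,\mathsf{P})$ if $s'\xrightarrow{\sigma}{}'\mu'$ and $w\in\mathrm{Couplings}(\mu,\mu')$; from $(s,\sigma^2,s',-,\mu',-,\mathsf{V})$ with $\sigma\notin\mathcal{F}$ to $(s,-,s',\mu,\mu',w,\mathsf{P})$ if $s\xrightarrow{\sigma}\mu$ and $w\in\mathrm{Couplings}(\mu,\mu')$; from $(s,F^2,s',-,\mu',-,\mathsf{V})$ with $F\in\mathcal{F}$ to $(s,-,s',\Delta_s,\mu',w,\mathsf{P})$ with $w\in\mathrm{Couplings}(\Delta_s,\mu')$;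 from $(s,-,s',\mu,\mu',w,\mathsf{P})$ to $(t,-,t',-,-,-,\mathsf{R})$ with probability $w(t,t')$; any Verifier vertex with no other successor, and $v_{\text{err}}$, has an edge to $v_{\text{err}}$. The symbolic game graph $\mathcal{SG}_{A,A'}$ has the same Refuter and Verifier vertices and edges with the coupling component dropped: Refuter vertices $(s,-,s',-,-,\mathsf{R})$ and $v_{\text{err}}$, Verifier vertices $(s,\sigma^1,s',\mu,-,\mathsf{V})$, $(s,\sigma^2,s',-,\mu',\mathsf{V})$, probabilistic vertices $(s,-,s',\mu,\mu',\mathsf{P})$ (same existence condition), initial vertex $v_0^{\mathcal{SG}}=(s_0,-,s'_0,-,-,\mathsf{R})$, and a probabilistic vertex $(s,-,s',\mu,\mu',\mathsf{P})$ has (non-probabilistic) edges to all $(t,-,t',-,-,\mathsf{R})$ with $t\in\mathrm{Supp}(\mu)$, $t'\in\mathrm{Supp}(\mu')$. $\mathit{Post}^{\mathcal{SG}}(v)$ denotes the set of successors of $v$ in $\mathcal{SG}_{A,A'}$. For each probabilistic vertex $v=(s,-,s',\mu,\mu',\mathsf{P})$, $\mathit{Eq}(v)$ is the linear system in variables $x_{t,t'}$ ($t\in\mathrm{Supp}(\mu)$, $t'\in\mathrm{Supp}(\mu')$): $\sum_{t'}x_{t,t'}=\mu(t)$ for each $t$, $\sum_{t}x_{t,t'}=\mu'(t')$ for each $t'$, $x_{t,t'}\ge 0$ (its solutions are exactly the couplings for $(\mu,\mu')$). For a set $V'$ of Refuter vertices, $\mathit{Eq}(v,V')$ is $\mathit{Eq}(v)$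 plus the equation $\sum_{(t,-,t',-,-,\mathsf{R})\in V'}x_{t,t'}=0$. $U=\bigcup_{i\ge0}U^i$ where $U^0=\{v_{\text{err}}\}$ and $U^{i+1}$ is the union of: the Refuter vertices $v'$ with $\mathit{Post}^{\mathcal{SG}}(v')\cap\bigcup_{j\le i}U^j\neq\emptyset$; the Verifier vertices $v'$ with $\mathit{Post}^{\mathcal{SG}}(v')\subseteq\bigcup_{j\le i}U^j$; and the probabilistic vertices $v'$ such that $\mathit{Eq}(v',\mathit{Post}^{\mathcal{SG}}(v')\cap\bigcup_{j\le i}U^j)$ has no solution. *)

(* Defs.v *)
From HB Require Import structures.
From mathcomp Require Import all_boot all_order all_algebra.
From mathcomp Require Import all_classical all_reals all_analysis.

Set Implicit Arguments.
Unset Strict Implicit.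
Unset Printing Implicit Defensive.

Import Order.TTheory GRing.Theory Num.Theory.

Local Open Scope classical_set_scope.
Local Open Scope ring_scope.

Section Distributions.
Variable R : realType.

Record fdist (T : finType) := FDist {
  pmf :> {ffun T -> R};
  pmf_ge0 : forall t, 0 <= pmf t;
  pmf_sum1 : \sum_t pmf t = 1 }.

Definition supp (T : finType) (mu : fdist T) : pred T := fun t => 0 < mu t.

Definition dirac_pmf (T : finType) (s : T) : {ffun T -> R} :=
  [ffun t => (t == s)%:R].

Lemma dirac_pmf_ge0 (T : finType) (s t : T) : 0 <= dirac_pmf s t.
Proof. by rewrite ffunE ler0n. Qed.

Lemma dirac_pmf_sum1 (T : finType) (s : T) : \sum_t dirac_pmf s t = 1.
Proof.
rewrite (bigD1 s) //= ffunE eqxx big1 ?addr0// => t ts.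
by rewrite ffunE (negbTE ts).
Qed.

Definition fdirac (T : finType) (s : T) : fdist T :=
  FDist (@dirac_pmf_ge0 T s) (dirac_pmf_sum1 s).

Definition couplings (S S' : finType) (mu : fdist S) (mu' : fdist S') :
    set (fdist (S * S')%type) :=
  [set w | (forall s, \sum_s' w (s, s') = mu s) /\
           (forall s', \sum_s w (s, s') = mu' s')].

(* Discrete distributions on an arbitrary, possibly uncountable, type: the
   sum being finite, the support is countable. *)
Definition is_ddist (T : choiceType) (f : T -> R) : Prop :=
  (forall t, 0 <= f t) /\ (\esum_(t in [set: T]) (f t)%:E = 1)%E.

End Distributions.

Section StochasticGames.
Variable R : realType.

Inductive owner_kind := Refuter | Verifier | Probabilistic.

(* [gdelta v] is meaningful on probabilistic vertices only.  The pointed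
   structure is what the library requires to generate a sigma-algebra. *)
Record game_graph := GameGraph {
  gvertex : pointedType;
  gowner : gvertex -> owner_kind;
  gedge : gvertex -> gvertex -> Prop;
  gdelta : gvertex -> gvertex -> R;
  ginit : gvertex }.

Variable G : game_graph.
Local Notation V := (gvertex G).

(* A randomized history-dependent strategy of player [o]: [st h v] is the move
   after the history [h] followed by the current vertex [v]; it is constrained
   only where [o] has to move. *)
Record strategy (o : owner_kind) := Strategy {
  st :> seq V -> V -> V -> R;
  st_ddist : forall h v, gowner v = o -> is_ddist (st h v);
  st_post : forall h v v', gowner v = o -> 0 < st h v v' -> gedge v v' }.

Definition step (piR : strategy Refuter) (piV : strategy Verifier)
    (h : seq V) (v : V) : V -> R :=
  match gowner v with
  | Refuter => piR h v
  | Verifier => piV h v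
  | Probabilistic => gdelta v
  end.

Definition play := nat -> V.

Definition outcome (piR : strategy Refuter) (piV : strategy Verifier) :
    set play :=
  [set om | om 0%N = ginit G /\
            forall i, 0 < step piR piV (mkseq om i) (om i) (om i.+1)].

(* The product sigma-algebra for the discrete sigma-algebra on [V].  As [V] may
   be uncountable, the cones of finite paths alone would not make reachability
   events measurable. *)
Definition coordinate_sets : set (set play) :=
  [set C | exists n (B : set V), C = [set om | B (om n)]].

Definition playT := g_sigma_algebraType coordinate_sets.

Definition cone (om : play) (n : nat) : set play :=
  [set om' | forall i, (i <= n)%N -> om' i = om i].

(* [P] is the law of the Markov chain induced by the two strategies from the
   initial vertex.  The steps being discrete, the values on cones determine [P]
   on the whole sigma-algebra. *)
Definition is_play_law (piR : strategy Refuter) (piV : strategy Verifier)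
    (P : probability playT R) : Prop :=
  forall (om : play) (n : nat),
    P (cone om n) =
    ((om 0%N == ginit G)%:R *
     \prod_(i < n) step piR piV (mkseq om i) (om i) (om i.+1))%:E.

Definition sure_winning (piV : strategy Verifier) (Phi : set play) : Prop :=
  forall piR, outcome piR piV `<=` Phi.

Definition almost_sure_winning (piV : strategy Verifier) (Phi : set play) :
    Prop :=
  forall piR, exists P : probability playT R,
    is_play_law piR piV P /\ P Phi = 1%E.

End StochasticGames.

Record PTS (R : realType) (S L : finType) := MkPTS {
  pts_trans : set (S * L * fdist R S);
  pts_init : S;
  pts_finite : finite_set pts_trans;
  pts_total : forall s, exists a mu, pts_trans (s, a, mu) }.

Section MaskingGame.
Variables (R : realType) (S S' Act Flt : finType).
(* The labels of the implementation form the disjoint union of the actions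
   ([inl]) and of the faults ([inr]). *)
Variables (A : PTS R S Act) (A' : PTS R S' (Act + Flt)%type).

Definition trans (s : S) (a : Act) (mu : fdist R S) : Prop :=
  pts_trans A (s, a, mu).
Definition trans' (s' : S') (a : (Act + Flt)%type) (mu' : fdist R S') : Prop :=
  pts_trans A' (s', a, mu').

Definition nominal_move (s : S) (a : (Act + Flt)%type) (mu : fdist R S) :
    Prop :=
  match a with
  | inl b => trans s b mu
  | inr _ => mu = fdirac R s
  end.

Definition prob_vertex_cond (s : S) (s' : S') (mu : fdist R S)
    (mu' : fdist R S') : Prop :=
  exists a, nominal_move s a mu /\ trans' s' a mu'.

Inductive mvertex :=
| MErr
| MR (s : S) (s' : S')
| MV1 (s : S) (a : Act) (s' : S') (mu : fdist R S) of trans s a mu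
| MV2 (s : S) (a : (Act + Flt)%type) (s' : S') (mu' : fdist R S')
    of trans' s' a mu'
| MP (s : S) (s' : S') (mu : fdist R S) (mu' : fdist R S')
    (w : fdist R (S * S')%type)
    of couplings mu mu' w & prob_vertex_cond s s' mu mu'.

HB.instance Definition _ := gen_eqMixin mvertex.
HB.instance Definition _ := gen_choiceMixin mvertex.
HB.instance Definition _ := isPointed.Build mvertex MErr.

Definition mowner (v : mvertex) : owner_kind :=
  match v with
  | MErr | MR _ _ => Refuter
  | MV1 _ _ _ _ _ | MV2 _ _ _ _ _ => Verifier
  | MP _ _ _ _ _ _ _ => Probabilistic
  end.

Definition mdelta (v v' : mvertex) : R :=
  match v, v' with
  | MP _ _ _ _ w _ _, MR t t' => w (t, t')
  | _, _ => 0
  end.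

(* The edges other than those leading to the error vertex. *)
Definition medge0 (v v' : mvertex) : Prop :=
  match v, v' with
  | MR s s', MV1 s1 a s1' mu _ => [/\ s1 = s, s1' = s' & trans s a mu]
  | MR s s', MV2 s1 a s1' mu' _ => [/\ s1 = s, s1' = s' & trans' s' a mu']
  | MV1 s a s' mu _, MP s1 s1' mu1 mu1' w _ _ =>
      [/\ s1 = s, s1' = s', mu1 = mu, trans' s' (inl a) mu1'
        & couplings mu mu1' w]
  | MV2 s (inl a) s' mu' _, MP s1 s1' mu1 mu1' w _ _ =>
      [/\ s1 = s, s1' = s', mu1' = mu', trans s a mu1 & couplings mu1 mu' w]
  | MV2 s (inr _) s' mu' _, MP s1 s1' mu1 mu1' w _ _ =>
      [/\ s1 = s, s1' = s', mu1' = mu', mu1 = fdirac R s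
        & couplings (fdirac R s) mu' w]
  | MP _ _ _ _ _ _ _, MR _ _ => 0 < mdelta v v'
  | _, _ => False
  end.

Definition medge (v v' : mvertex) : Prop :=
  medge0 v v' \/
  (v' = MErr /\
   (v = MErr \/ (mowner v = Verifier /\ ~ exists v1, medge0 v v1))).

Definition masking_game : game_graph R :=
  @GameGraph R mvertex mowner medge mdelta (MR (pts_init A) (pts_init A')).

Definition never_err : set (play masking_game) :=
  [set om | forall n, om n <> MErr].

Inductive svertex :=
| SErr
| SR (s : S) (s' : S')
| SV1 (s : S) (a : Act) (s' : S') (mu : fdist R S) of trans s a mu
| SV2 (s : S) (a : (Act + Flt)%type) (s' : S') (mu' : fdist R S')
    of trans' s' a mu'
| SP (s : S) (s' : S') (mu : fdist R S) (mu' : fdist R S')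
    of prob_vertex_cond s s' mu mu'.

Definition sowner (v : svertex) : owner_kind :=
  match v with
  | SErr | SR _ _ => Refuter
  | SV1 _ _ _ _ _ | SV2 _ _ _ _ _ => Verifier
  | SP _ _ _ _ _ => Probabilistic
  end.

Definition sedge0 (v v' : svertex) : Prop :=
  match v, v' with
  | SR s s', SV1 s1 a s1' mu _ => [/\ s1 = s, s1' = s' & trans s a mu]
  | SR s s', SV2 s1 a s1' mu' _ => [/\ s1 = s, s1' = s' & trans' s' a mu']
  | SV1 s a s' mu _, SP s1 s1' mu1 mu1' _ =>
      [/\ s1 = s, s1' = s', mu1 = mu & trans' s' (inl a) mu1']
  | SV2 s (inl a) s' mu' _, SP s1 s1' mu1 mu1' _ =>
      [/\ s1 = s, s1' = s', mu1' = mu' & trans s a mu1]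
  | SV2 s (inr _) s' mu' _, SP s1 s1' mu1 mu1' _ =>
      [/\ s1 = s, s1' = s', mu1' = mu' & mu1 = fdirac R s]
  | SP _ _ mu mu' _, SR t t' => supp mu t /\ supp mu' t'
  | _, _ => False
  end.

Definition sedge (v v' : svertex) : Prop :=
  sedge0 v v' \/
  (v' = SErr /\
   (v = SErr \/ (sowner v = Verifier /\ ~ exists v1, sedge0 v v1))).

Definition sinit : svertex := SR (pts_init A) (pts_init A').

Definition spost (v : svertex) : set svertex := [set v' | sedge v v'].

(* [x] solves the system of the probabilistic vertex with distributions
   [mu], [mu'], augmented by the equation for [V'].  Only the values of [x] on
   supp mu x supp mu' are variables of the system. *)
Definition eq_solution (mu : fdist R S) (mu' : fdist R S')
    (V' : set svertex) (x : S -> S' -> R) : Prop :=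
  [/\ forall t, supp mu t -> \sum_(t' | supp mu' t') x t t' = mu t,
      forall t', supp mu' t' -> \sum_(t | supp mu t) x t t' = mu' t',
      forall t t', supp mu t -> supp mu' t' -> 0 <= x t t'
    & \sum_(t | supp mu t) \sum_(t' | supp mu' t' && `[< V' (SR t t') >])
        x t t' = 0].

Definition eq_solvable (v : svertex) (V' : set svertex) : Prop :=
  match v with
  | SP _ _ mu mu' _ => exists x, eq_solution mu mu' V' x
  | _ => True
  end.

(* U^{i+1} in terms of W, the union of the U^j for j <= i *)
Definition U_next (W : set svertex) : set svertex :=
  [set v | match sowner v with
           | Refuter => spost v `&` W !=set0
           | Verifier => spost v `<=` W
           | Probabilistic => ~ eq_solvable v (spost v `&` W)
           end].

(* the union of the U^j for j <= i *)
Fixpoint U_upto (i : nat) : set svertex :=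
  match i with
  | 0%N => [set SErr]
  | j.+1 => U_upto j `|` U_next (U_upto j)
  end.

Definition U_level (i : nat) : set svertex :=
  match i with
  | 0%N => [set SErr]
  | j.+1 => U_next (U_upto j)
  end.

Definition U : set svertex := \bigcup_i U_level i.

End MaskingGame.

Arguments never_err {R S S' Act Flt} A A'.

(* Main.v *)
(** The Verifier wins from a vertex outside [U] by a pure memoryless strategy.
    The successor sets in the symbolic graph are finite, so [U] is a genuine
    fixpoint of its defining operator: a Verifier vertex outside [U] has a
    symbolic successor outside [U], and the linear system of a probabilistic
    vertex outside [U] has a solution, that is, a coupling charging no pair in
    [U].  Playing these couplings, no play consistent with the strategy ever
    enters [U].  Conversely, inside [U] the Refuter decreases the rank at his
    vertices, while at the other vertices some move of positive probability
    does so, whatever the Verifier plays (an unsolvable system means that every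
    coupling charges a pair of lower rank).  Hence some finite path of positive
    probability leads to the error vertex, which refutes both sure and
    almost-sure winning.

    Against a pure Verifier strategy all steps have finite support, and the law
    of the play is obtained as the image of Lebesgue measure on [0, 1[: the unit
    interval is successively cut into pieces whose lengths are the probabilities
    of the finite paths, and a parameter is mapped to the play that it
    follows. *)

Require Import Defs.
From mathcomp Require Import all_boot all_order all_algebra.
From mathcomp Require Import all_classical all_reals all_analysis.
From mathcomp Require Import lra.

Set Implicit Arguments.
Unset Strict Implicit.
Unset Printing Implicit Defensive.

Import Order.TTheory GRing.Theory Num.Theory.

Local Open Scope classical_set_scope.
Local Open Scope ring_scope.

(** * Functions of finite range with measurable fibres *)

(** The target carries no sigma-algebra, so the preimage of every subset must be measurable;
    finiteness of the range is what makes the notion stable under dependent composition. *)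
Definition finitely_measurable (d : measure_display) (X : measurableType d)
    (T : Type) (g : X -> T) : Prop :=
  finite_set (range g) /\ forall B : set T, measurable (g @^-1` B).

Section FinitelyMeasurable.
Context (d : measure_display) (X : measurableType d).

Lemma finitely_measurable_cst (T : Type) (x : T) :
  finitely_measurable (fun _ : X => x).
Proof.
split; first exact: finite_image_cst.
by move=> B; rewrite preimage_cst; case: ifP.
Qed.

Lemma finitely_measurable_if (T : Type) (D : X -> bool) (f g : X -> T) :
  measurable [set u | D u] -> finitely_measurable f -> finitely_measurable g ->
  finitely_measurable (fun u => if D u then f u else g u).
Proof.
move=> mD [finf mf] [fing mg]; split.
  apply: (@sub_finite_set _ _ (range f `|` range g)).
    by move=> _ [u _ <-]; case: ifP => _; [left | right]; exists u.
  by rewrite finite_setU.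
move=> B.
rewrite (_ : _ @^-1` B = ([set u | D u] `&` f @^-1` B) `|`
                         (~` [set u | D u] `&` g @^-1` B)).
  by apply: measurableU; apply: measurableI => //; exact: measurableC.
apply/seteqP; split => u /=; first by case: ifP => Du Bu; [left | right].
by case=> -[]; [move=> -> | move=> /negP/negbTE ->].
Qed.

(** The preimage splits along the finitely many values of [g]; on each fibre only one [k t] is
    involved. *)
Lemma finitely_measurable_bind (T U : Type) (g : X -> T) (k : T -> X -> U) :
  finitely_measurable g -> (forall t, finitely_measurable (k t)) ->
  finitely_measurable (fun u => k (g u) u).
Proof.
move=> [fing mg] fmk; split.
  apply: (@sub_finite_set _ _ (\bigcup_(t in range g) range (k t))).
    by move=> _ [u _ <-]; exists (g u); exists u.
  by apply: bigcup_finite => // t _; case: (fmk t).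
move=> B.
rewrite (_ : _ @^-1` B =
             \bigcup_(t in range g) (g @^-1` [set t] `&` k t @^-1` B)).
  apply: fin_bigcup_measurable => // t _.
  by apply: measurableI; [exact: mg | case: (fmk t)].
apply/seteqP; split => u /=; first by move=> Bu; exists (g u) => //; exists u.
by case=> t _ [/= ->].
Qed.

End FinitelyMeasurable.

(** * Cutting an interval proportionally to a distribution *)

Section Pick.
Context (R : realType) (V : pointedType) (f : V -> R) (l : R).

(* The interval [a, a + l * sum_s f[ is cut into consecutive pieces of lengths
   l * f x for x in s; the result is the label and the left end of the piece
   containing u. *)
Fixpoint pick_piece (s : seq V) (a u : R) : V * R :=
  if s is x :: s' then
    if u < a + l * f x then (x, a) else pick_piece s' (a + l * f x) u
  else (point, a).

(** Scaled by [l], this is the offset of the left end of the first piece labelled [x]. *)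
Fixpoint mass_before (s : seq V) (x : V) : R :=
  if s is y :: s' then if y == x then 0 else f y + mass_before s' x else 0.

Hypothesis f_ge0 : forall x, 0 <= f x.
Hypothesis l_ge0 : 0 <= l.

Lemma mass_before_ge0 s x : 0 <= mass_before s x.
Proof. by elim: s => //= y s IH; case: ifP => // _; rewrite addr_ge0. Qed.

Lemma mass_before_le s x : x \in s ->
  mass_before s x + f x <= \sum_(y <- s) f y.
Proof.
elim: s => //= y s IH; rewrite inE big_cons eq_sym; case: eqP => [->|_] /=.
  by move=> _; rewrite add0r lerDl sumr_ge0.
by move/IH; rewrite -addrA lerD2l.
Qed.

Lemma pick_piece_in s a u : a <= u < a + l * \sum_(x <- s) f x ->
  let: (x, b) := pick_piece s a u in x \in s /\ b <= u < b + l * f x.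
Proof.
elim: s a => [|x s IH] a /=.
  by rewrite big_nil mulr0 addr0 => /andP[/le_lt_trans h /h]; rewrite ltxx.
rewrite big_cons mulrDr addrA => /andP[au ub].
case: ltP => [uax|axu]; first by rewrite au uax mem_head.
have /IH : a + l * f x <= u < a + l * f x + l * \sum_(x <- s) f x.
  by rewrite axu.
by case: pick_piece => y b [ys ->]; rewrite inE ys orbT.
Qed.

Lemma pick_piece_eq s a u x : x \in s ->
  a + l * mass_before s x <= u < a + l * mass_before s x + l * f x ->
  pick_piece s a u = (x, a + l * mass_before s x).
Proof.
elim: s a => //= y s IH a; rewrite inE eq_sym; case: eqP => [->|_] /=.
  by rewrite mulr0 addr0 => _ /andP[_ ->].
move=> xs; rewrite mulrDr addrA => /[dup] h /(IH _ xs) ->.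
(* The piece of [x] starts to the right of the piece of [y], so [u] cannot lie in the latter. *)
case: ltP => // uay; case/andP: h => h _; exfalso.
have := mulr_ge0 l_ge0 (mass_before_ge0 s x); lra.
Qed.

(** Since no label is repeated, the label returned determines the piece and hence its left end. *)
Lemma pick_piece_left s a u : uniq s ->
  a <= u < a + l * \sum_(x <- s) f x ->
  (pick_piece s a u).2 = a + l * mass_before s (pick_piece s a u).1.
Proof.
elim: s a => [|x s IH] a /=; first by rewrite mulr0 addr0.
case/andP => xs us; rewrite big_cons mulrDr addrA => /andP[au ub].
case: ltP => [uax|axu] /=; first by rewrite eqxx mulr0 addr0.
have h : a + l * f x <= u < a + l * f x + l * \sum_(x <- s) f x.
  by rewrite axu.
rewrite IH //; have := pick_piece_in h.
case: pick_piece => y b /= [ys _]; case: eqP => [xy|_].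
  by rewrite xy ys in xs.
by rewrite mulrDr addrA.
Qed.

Lemma finitely_measurable_pick_piece s a :
  finitely_measurable (pick_piece s a : measurableTypeR R -> V * R).
Proof.
elim: s a => [|x s IH] a /=; first exact: finitely_measurable_cst.
apply: finitely_measurable_if => //; last exact: finitely_measurable_cst.
rewrite (_ : [set u | _] = `]-oo, a + l * f x[%classic).
  exact: measurable_itv.
by apply/seteqP; split => u /=; rewrite in_itv.
Qed.

End Pick.

(** * Sampling a path from a parameter in the unit interval *)

Section Sampling.
Context (R : realType) (V : pointedType).
Context (K : seq V -> V -> V -> R) (succ : seq V -> V -> seq V) (v0 : V).
Hypothesis K_ge0 : forall h v x, 0 <= K h v x.
Hypothesis K_supp : forall h v x, x \notin succ h v -> K h v x = 0.
Hypothesis K_sum1 : forall h v, \sum_(x <- succ h v) K h v x = 1.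
Hypothesis succ_uniq : forall h v, uniq (succ h v).

(* The components are the history, the current vertex, and the left end and the
   length of the interval of the parameters that follow the same path. *)
Fixpoint sample_state (n : nat) (u : R) : seq V * V * R * R :=
  if n is n'.+1 then
    let: (h, v, a, l) := sample_state n' u in
    let: (x, b) := pick_piece (K h v) l (succ h v) a u in
    (rcons h v, x, b, l * K h v x)
  else ([::], v0, 0, 1).

Definition sample (u : R) (n : nat) : V := (sample_state n u).1.1.2.

Lemma finitely_measurable_sample_state n :
  finitely_measurable (sample_state n : measurableTypeR R -> _).
Proof.
elim: n => [|n IH] /=; first exact: finitely_measurable_cst.
pose k (t : seq V * V * R * R) (u : measurableTypeR R) :=
  let: (h, v, a, l) := t in
  let: (x, b) := pick_piece (K h v) l (succ h v) a u in
  (rcons h v, x, b, l * K h v x).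
apply: (@finitely_measurable_bind _ _ _ _ _ k IH) => -[[[h v] a] l].
apply: (@finitely_measurable_bind _ _ _ _
  (pick_piece (K h v) l (succ h v) a : measurableTypeR R -> _)
  (fun t _ => (let: (x, b) := t in (rcons h v, x, b, l * K h v x)))).
  exact: finitely_measurable_pick_piece.
by move=> [x b]; exact: finitely_measurable_cst.
Qed.

Lemma sample_state_hist n u : (sample_state n u).1.1.1 = mkseq (sample u) n.
Proof.
elim: n => //= n IH; rewrite mkseqS -IH /sample.
by case: (sample_state n u) => -[[h v] a] l /=; case: pick_piece.
Qed.

(** The step probabilities sum to 1, so the pieces cover the current interval and the parameter
    always falls in one of them. *)
Lemma sample_state_itv n u : 0 <= u < 1 ->
  let: (h, v, a, l) := sample_state n u in 0 <= l /\ a <= u < a + l.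
Proof.
move=> u01; elim: n => [|n] /=; first by rewrite add0r ler01.
case: (sample_state n u) => -[[h v] a] l [l0 ual].
have := @pick_piece_in _ _ (K h v) l (succ h v) a u.
rewrite K_sum1 mulr1 => /(_ ual); case: pick_piece => x b [_ ?].
by rewrite mulr_ge0.
Qed.

(** Pieces are half-open, so a piece of length 0 is empty. Hence every parameter, not merely almost
    every one, takes only steps of positive probability. *)
Lemma sample_step n u : 0 <= u < 1 ->
  0 < K (mkseq (sample u) n) (sample u n) (sample u n.+1).
Proof.
move=> u01; rewrite -sample_state_hist /sample /=.
have := @sample_state_itv n u u01.
case: (sample_state n u) => -[[h v] a] l [l0 ual] /=.
have := @pick_piece_in _ _ (K h v) l (succ h v) a u.
rewrite K_sum1 mulr1 => /(_ ual); case: pick_piece => x b [_ /andP[bu ub]] /=.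
rewrite lt_neqAle K_ge0 andbT eq_sym; apply/negP => /eqP K0.
by move: (le_lt_trans bu ub); rewrite K0 mulr0 addr0 ltxx.
Qed.

(** By induction on [n]: the piece of the next vertex is a half-open subinterval, its length
    multiplied by the step probability. The first conjunct records the whole state, from which the
    next cut is computed. *)
Lemma sample_cone_itv (om : nat -> V) (n : nat) : om 0%N = v0 ->
  let len := \prod_(i < n) K (mkseq om i) (om i) (om i.+1) in
  exists a, [/\ 0 <= a, a + len <= 1 & forall u, 0 <= u < 1 ->
    ((forall i, (i <= n)%N -> sample u i = om i) ->
       sample_state n u = (mkseq om n, om n, a, len)) /\
    ((forall i, (i <= n)%N -> sample u i = om i) <-> a <= u < a + len)].
Proof.
move=> om0; elim: n => [|n [a [a0 alen IH]]] /=.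
  rewrite big_ord0; exists 0; rewrite add0r; split => // u u01; split.
    by move=> _; rewrite om0.
  by split => // _ [|//] _; rewrite om0.
rewrite big_ord_recr /=.
set len := \prod_(i < n) _ in alen IH *.
have len0 : 0 <= len by apply: prodr_ge0 => i _.
set f := K (mkseq om n) (om n); set s := succ (mkseq om n) (om n).
have f0 x : 0 <= f x by exact: K_ge0.
have prefix u : (forall i, (i <= n.+1)%N -> sample u i = om i) <->
    (forall i, (i <= n)%N -> sample u i = om i) /\ sample u n.+1 = om n.+1.
  split=> [h|[h1 h2] i]; first by split=> [i /leqW /h //|]; exact: h.
  by rewrite leq_eqVlt => /orP[/eqP ->|/h1].
have next u : 0 <= u < 1 -> (forall i, (i <= n)%N -> sample u i = om i) ->
    sample_state n.+1 u =
      (let: (x, b) := pick_piece f len s a u in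
       (mkseq om n.+1, x, b, len * f x)).
  move=> u01 /(IH u u01).1 /= ->; rewrite mkseqS /f /s.
  by case: pick_piece.
case: (boolP (om n.+1 \in s)) => xs; last first.
  (* A vertex outside [succ] is never picked and has probability 0: the interval is empty, and [a]
     serves as its left end. *)
  rewrite /f K_supp // mulr0; exists a; rewrite addr0; split => //.
    by apply: le_trans alen; rewrite lerDl.
  move=> u u01.
  suff h : ~ (forall i, (i <= n.+1)%N -> sample u i = om i).
    split=> [/h //|]; split=> [/h //|/andP[/le_lt_trans au /au]].
    by rewrite ltxx.
  move/prefix => [h e]; move: e; rewrite /sample next //.
  have := (IH u u01).2.1 h; have := @pick_piece_in _ _ f len s a u.
  rewrite K_sum1 mulr1 => /[apply]; case: pick_piece => y b /= [ys _] ey.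
  by rewrite -ey ys in xs.
have mb0 := mulr_ge0 len0 (mass_before_ge0 f0 s (om n.+1)).
have mble : len * mass_before f s (om n.+1) + len * f (om n.+1) <= len.
  rewrite -mulrDr -[leRHS]mulr1 ler_wpM2l // -(K_sum1 (mkseq om n) (om n)).
  exact: mass_before_le.
exists (a + len * mass_before f s (om n.+1)); split.
- by rewrite addr_ge0.
- lra.
move=> u u01.
have fwd : (forall i, (i <= n.+1)%N -> sample u i = om i) ->
    sample_state n.+1 u = (mkseq om n.+1, om n.+1,
      a + len * mass_before f s (om n.+1), len * f (om n.+1)).
  move/prefix => [h]; rewrite /sample next //.
  have itv : a <= u < a + len * \sum_(x <- s) f x.
    by rewrite K_sum1 mulr1; exact/(IH u u01).2.
  have := pick_piece_left (succ_uniq _ _) itv.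
  by case: pick_piece => y b /= -> ->.
split=> //; split=> [/fwd e|itv].
  by have := sample_state_itv n.+1 u01; rewrite e => -[].
have h : forall i, (i <= n)%N -> sample u i = om i.
  by apply/(IH u u01).2; case/andP: itv => h1 h2; apply/andP; split; lra.
apply/prefix; split=> //; rewrite /sample next //.
by rewrite (pick_piece_eq f0 len0 xs itv).
Qed.

End Sampling.

(** * Existence of the law of the play *)

(** Normalizing a measure of mass 1 does not change it; [dirac point] is the fallback of
    [mnormalize] for mass 0 or infinity. *)
Lemma probability_of_measure (d : measure_display) (T : measurableType d)
    (R : realType) (mu : {measure set T -> \bar R}) :
  mu setT = 1%E -> exists P : probability T R, forall A, P A = mu A.
Proof.
move=> mu1; exists (mnormalize mu (dirac point)) => A.
by rewrite /= /mnormalize mu1 /= onee_eq0 /= invr1 mule1.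
Qed.

Section PlayLaw.
Context (R : realType) (G : game_graph R).
Context (piR : strategy G Refuter) (piV : strategy G Verifier).
Local Notation V := (gvertex G).

Definition finite_ddist (f : V -> R) (s : seq V) : Prop :=
  [/\ uniq s, forall x, x \notin s -> f x = 0 & \sum_(x <- s) f x = 1].

(** The law is the image of Lebesgue measure under [sample]. Every parameter yields an outcome, so
    the preimage of any set containing all outcomes is the whole unit interval. *)
Lemma play_law_exists :
  (forall h v x, 0 <= step piR piV h v x) ->
  (forall h v, exists s, finite_ddist (step piR piV h v) s) ->
  exists P : probability (playT G) R, is_play_law piR piV P /\
    forall Phi, outcome piR piV `<=` Phi -> P Phi = 1%E.
Proof.
move=> K0 fin.
pose succ h v := projT1 (cid (fin h v)).
have succP h v : finite_ddist (step piR piV h v) (succ h v).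
  by rewrite /succ; case: cid.
have K_supp h v x : x \notin succ h v -> step piR piV h v x = 0.
  by case: (succP h v) => _ /(_ x).
have K_sum1 h v : \sum_(x <- succ h v) step piR piV h v x = 1.
  by case: (succP h v).
have succ_uniq h v : uniq (succ h v) by case: (succP h v).
pose X : measurableTypeR R -> playT G :=
  sample (step piR piV) succ (ginit G).
have mX : measurable_fun setT X.
  apply: (@measurability _ _ _ _ setT X (@coordinate_sets _ G)) => //.
  move=> _ [_ [n [B ->]] <-]; rewrite setTI.
  have [_ m] := finitely_measurable_sample_state (step piR piV) succ (ginit G) n.
  (* The coordinate [n] of the play is the vertex component of the state. *)
  exact: (m [set t | B t.1.1.2]).
have mI : measurable (`[0, 1[%classic : set (measurableTypeR R)).
  exact: measurable_itv.
pose P0 : {measure set (playT G) -> \bar R} :=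
  measure_function_pushforward__canonical__measure_function_Measure
    (mrestr (@lebesgue_measure R) mI) mX.
have P0E Phi : P0 Phi = lebesgue_measure (X @^-1` Phi `&` `[0, 1[).
  by [].
have I1 : lebesgue_measure (`[0, 1[%classic : set R) = 1%E.
  by rewrite lebesgue_measure_itv /= lte01 oppr0 adde0.
have P0T : P0 setT = 1%E by rewrite P0E preimage_setT setTI.
have [P PE] := probability_of_measure P0T.
exists P; split=> [om n|Phi outPhi]; last first.
  rewrite PE P0E setIC setIidl // => u /=; rewrite in_itv /= => u01.
  apply: outPhi; split=> // i; exact: sample_step.
rewrite PE P0E.
have [om0|om0] := eqVneq (om 0%N) (ginit G); last first.
  rewrite mul0r (_ : _ `&` _ = set0) ?measure0 //.
  apply/seteqP; split=> // u [/= /(_ 0%N isT) e _].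
  by rewrite -e eqxx in om0.
rewrite mul1r.
have [a [a0 a1 h]] := sample_cone_itv K0 K_supp K_sum1 succ_uniq n om0.
set len := \prod_(i < n) _ in a1 h *.
have len0 : 0 <= len by apply: prodr_ge0 => i _.
rewrite (_ : _ `&` _ = `[a, a + len[%classic).
  rewrite lebesgue_measure_itv /= lte_fin ltrDl -EFinB addrAC subrr add0r.
  by case: ltP => // len0'; congr EFin; apply/eqP; rewrite eq_le len0.
apply/seteqP; split=> u /=; rewrite !in_itv /=.
  by move=> [c u01]; apply/(h u u01).2.
move=> /[dup] itv /andP[au ua].
have u01 : 0 <= u < 1 by apply/andP; split; lra.
by split=> //; apply/(h u u01).2.
Qed.

End PlayLaw.

(** * Discrete distributions *)

Section DiscreteDistributions.
Context (R : realType) (T : choiceType).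

Lemma esum_finite_support (f : T -> R) (s : seq T) :
  (forall x, 0 <= f x) -> uniq s -> (forall x, x \notin s -> f x = 0) ->
  (\esum_(x in [set: T]) (f x)%:E = (\sum_(x <- s) f x)%:E)%E.
Proof.
move=> f0 us fs.
transitivity (\esum_(x in [set` s]) (f x)%:E)%E.
  rewrite [RHS]esum_mkcond; apply: eq_esum => x _.
  by case: ifPn => //; rewrite mem_setE => /fs ->.
rewrite esum_fset //; last by move=> x _; rewrite lee_fin.
by rewrite -fsbig_seq // sumEFin.
Qed.

Lemma is_ddist_indicator (x : T) : is_ddist (fun y => (y == x)%:R : R).
Proof.
split=> [y|]; first exact: ler0n.
rewrite (@esum_finite_support _ [:: x]) ?big_seq1 ?eqxx // => y.
by rewrite inE => /negbTE ->.
Qed.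

Lemma is_ddist_pos (f : T -> R) : is_ddist f -> exists x, 0 < f x.
Proof.
move=> [f0 f1]; apply: contrapT => nex; move: f1.
rewrite esum1 => [[/eqP]|x _]; first by rewrite eq_sym oner_eq0.
congr EFin; apply/eqP; rewrite eq_le f0 andbT leNgt.
by apply/negP => fx; apply: nex; exists x.
Qed.

End DiscreteDistributions.

(** * Couplings and solutions of the linear systems *)

Section Couplings.
Context (R : realType) (S S' : finType) (mu : fdist R S) (mu' : fdist R S').

(** The product distribution. It lets symbolic steps into probabilistic vertices be lifted to the
    game. *)
Lemma coupling_exists : exists w, couplings mu mu' w.
Proof.
pose p : {ffun S * S' -> R} := [ffun t => mu t.1 * mu' t.2].
have p0 t : 0 <= p t by rewrite ffunE mulr_ge0 ?Defs.pmf_ge0.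
have pl t : \sum_t' p (t, t') = mu t.
  under eq_bigr do rewrite ffunE /=.
  by rewrite -mulr_sumr Defs.pmf_sum1 mulr1.
have pr t' : \sum_t p (t, t') = mu' t'.
  under eq_bigr do rewrite ffunE /=.
  by rewrite -mulr_suml Defs.pmf_sum1 mul1r.
have p1 : \sum_t p t = 1.
  rewrite -(Defs.pmf_sum1 mu) -(eq_bigr _ (fun t _ => pl t)) pair_bigA /=.
  by apply: eq_bigr => -[].
by exists (FDist p0 p1).
Qed.

Lemma coupling_supp w t t' : couplings mu mu' w -> 0 < w (t, t') ->
  supp mu t /\ supp mu' t'.
Proof.
move=> [wl wr] w0; split; rewrite /supp.
  rewrite -wl (bigD1 t') //= ltr_wpDr // sumr_ge0 // => *; exact: Defs.pmf_ge0.
rewrite -wr (bigD1 t) //= ltr_wpDr // sumr_ge0 // => *; exact: Defs.pmf_ge0.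
Qed.

Lemma coupling_eq0 w t t' : couplings mu mu' w ->
  ~~ (supp mu t && supp mu' t') -> w (t, t') = 0.
Proof.
move=> cw; have := Defs.pmf_ge0 w (t, t'); rewrite le_eqVlt => /orP[/eqP -> //|].
by move=> /(coupling_supp cw)[-> ->].
Qed.

End Couplings.

Section EqSystems.
Context (R : realType) (S S' Act Flt : finType).
Context (A : PTS R S Act) (A' : PTS R S' (Act + Flt)%type).
Context (mu : fdist R S) (mu' : fdist R S') (W : set (svertex A A')).

(** A coupling vanishes outside the product of the supports, so its marginals are already the sums
    over the variables of the system. *)
Lemma coupling_eq_solution w : couplings mu mu' w ->
  (forall t t', 0 < w (t, t') -> ~ W (SR A A' t t')) ->
  eq_solution mu mu' W (fun t t' => w (t, t')).
Proof.
move=> cw wW; have [wl wr] := cw; split.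
- move=> t ts; rewrite -wl [RHS](bigID (supp mu')) /= [X in _ = _ + X]big1.
    by rewrite addr0.
  by move=> t' /negbTE t's; rewrite (coupling_eq0 cw) // t's andbF.
- move=> t' t's; rewrite -wr [RHS](bigID (supp mu)) /= [X in _ = _ + X]big1.
    by rewrite addr0.
  by move=> t /negbTE ts; rewrite (coupling_eq0 cw) // ts.
- by move=> t t' _ _; exact: Defs.pmf_ge0.
- rewrite big1 // => t ts; rewrite big1 // => t' /andP[t's /asboolP Wt].
  have := Defs.pmf_ge0 w (t, t'); rewrite le_eqVlt => /orP[/eqP -> //|].
  by move/wW.
Qed.

(** Extend [x] by 0 outside the product of the supports. The additional equation is a vanishing sum
    of nonnegative terms, so each of its terms is 0. *)
Lemma eq_solution_coupling x : eq_solution mu mu' W x ->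
  exists w, couplings mu mu' w /\
    forall t t', 0 < w (t, t') -> ~ W (SR A A' t t').
Proof.
move=> [xl xr x0 xW].
pose p : {ffun S * S' -> R} :=
  [ffun t => if supp mu t.1 && supp mu' t.2 then x t.1 t.2 else 0].
have supp0 (T : finType) (nu : fdist R T) t : ~~ supp nu t -> nu t = 0.
  by rewrite -leNgt => h; apply/eqP; rewrite eq_le h Defs.pmf_ge0.
have p0 t : 0 <= p t.
  by rewrite ffunE; case: ifP => // /andP[]; exact: x0.
have pl t : \sum_t' p (t, t') = mu t.
  under eq_bigr do rewrite ffunE /=.
  have [ts|ts] := boolP (supp mu t); last by rewrite big1 // supp0.
  by rewrite -big_mkcond /= xl.
have pr t' : \sum_t p (t, t') = mu' t'.
  under eq_bigr do rewrite ffunE /= andbC.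
  have [ts|ts] := boolP (supp mu' t'); last by rewrite big1 // supp0.
  by rewrite -big_mkcond /= xr.
have p1 : \sum_t p t = 1.
  rewrite -(Defs.pmf_sum1 mu) -(eq_bigr _ (fun t _ => pl t)) pair_bigA /=.
  by apply: eq_bigr => -[].
exists (FDist p0 p1); split=> // t t' /=; rewrite ffunE /=.
case: ifP => [/andP[ts t's]|_]; last by rewrite ltxx.
move=> xpos Wt; move: xW => /eqP; apply/negP.
rewrite gt_eqF // (bigD1 t) //= ltr_wpDr //.
  apply: sumr_ge0 => u /andP[us _]; apply: sumr_ge0 => u' /andP[u's _].
  exact: x0.
rewrite (bigD1 t') /=; last by rewrite t's; apply/asboolP.
rewrite ltr_wpDr // sumr_ge0 // => u' /andP[/andP[u's _] _].
exact: x0.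
Qed.

End EqSystems.

(** * The set [U] as a fixpoint *)

(** Each element of [F] appears at some stage; the maximum of these finitely many stages works. *)
Lemma finite_set_sub_nondecreasing (T : Type) (F : set T) (W : nat -> set T) :
  finite_set F -> (forall i j, (i <= j)%N -> W i `<=` W j) ->
  F `<=` \bigcup_i W i -> exists n, F `<=` W n.
Proof.
move=> finF monoW FW.
have rk x : exists i, F x -> W i x.
  by have [/FW[i _ ?]|nF] := pselect (F x); [exists i | exists 0%N].
have [r rP] := choice rk.
have /(finite_image r)/finite_seqP[s rF] := finF.
exists (\max_(i <- s) i)%N => x Fx; apply: (monoW (r x)); last exact: rP.
apply: (leq_bigmax_seq (F := id)) => //.
by have : (r @` F) (r x) by [exists x]; rewrite rF.
Qed.

Section Attractor.
Context (R : realType) (S S' Act Flt : finType).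
Context (A : PTS R S Act) (A' : PTS R S' (Act + Flt)%type).
Local Notation SR := (@SR R S S' Act Flt A A').
Local Notation SErr := (@SErr R S S' Act Flt A A').
Local Notation U := (@U R S S' Act Flt A A').
Implicit Types (v : svertex A A').

Lemma U_upto_nondecreasing i j : (i <= j)%N ->
  (U_upto i : set (svertex A A')) `<=` U_upto j.
Proof.
elim: j => [|j IH]; first by rewrite leqn0 => /eqP ->.
by rewrite leq_eqVlt => /orP[/eqP -> //|/IH h v /h]; left.
Qed.

Lemma U_eq_bigcup_upto : U = \bigcup_i U_upto i.
Proof.
apply/seteqP; split=> v [i _].
  by case: i => [|i] h; [exists 0%N | exists i.+1 => //; right].
elim: i => [|i IH]; first by move=> h; exists 0%N.
by case=> [/IH //|h]; exists i.+1.
Qed.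

Lemma U_refuter v v' : sowner v = Refuter -> sedge v v' -> U v' -> U v.
Proof.
move=> ov e; rewrite [in U v']U_eq_bigcup_upto => -[i _ Uv'].
by exists i.+1 => //=; rewrite /U_next /= ov; exists v'.
Qed.

(** A total version of [SP], with dummy value [SErr], so that sets of probabilistic vertices can be
    bounded by images of finite sets. *)
Definition mkSP s s' mu mu' : svertex A A' :=
  match pselect (prob_vertex_cond A A' s s' mu mu') with
  | left H => SP H
  | right _ => SErr
  end.

Lemma mkSPE s s' mu mu' (H : prob_vertex_cond A A' s s' mu mu') :
  mkSP s s' mu mu' = SP H.
Proof.
by rewrite /mkSP; case: pselect => // H'; rewrite (Prop_irrelevance H' H).
Qed.

(** A successor is [SErr], or is determined by a transition of one of the finite relations, by the
    fault step alone, or by a pair of states. *)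
Lemma finite_spost v : sowner v <> Refuter -> finite_set (spost v).
Proof.
have finE (F : set (svertex A A')) : finite_set F ->
    finite_set (F `|` [set SErr]) by rewrite finite_setU.
case: v => //= [s a s' mu H|s a s' mu' H|s s' mu mu' H] _.
- apply: (sub_finite_set _ (finE _ (finite_image
    (fun t : S' * (Act + Flt) * fdist R S' => mkSP s s' mu t.2)
    (pts_finite A')))).
  move=> v' [|[-> _]]; last by right.
  case: v' => //= s1 s1' mu1 mu1' H1 [? ? ? tr]; subst; left.
  by exists (s', inl a, mu1') => //=; rewrite mkSPE.
- case: a H => [a|f] H.
  + apply: (sub_finite_set _ (finE _ (finite_image
      (fun t : S * Act * fdist R S => mkSP s s' t.2 mu') (pts_finite A)))).
    move=> v' [|[-> _]]; last by right.
    case: v' => //= s1 s1' mu1 mu1' H1 [? ? ? tr]; subst; left.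
    by exists (s, a, mu1) => //=; rewrite mkSPE.
  + apply: (sub_finite_set _ (finE _ (finite_set1
      (mkSP s s' (fdirac R s) mu')))).
    move=> v' [|[-> _]]; last by right.
    case: v' => //= s1 s1' mu1 mu1' H1 [? ? ? ?]; subst; left => /=.
    by rewrite mkSPE.
- apply: (sub_finite_set _ (finite_image
    (fun t : S * S' => SR t.1 t.2) (@finite_finset _ setT))).
  move=> v' [|[_ [|[]]] //]; case: v' => //= t t' _.
  by exists (t, t').
Qed.

(** By finiteness, all successors in [U] have appeared at a common stage; this closes [U] under the
    Verifier and probabilistic rules. *)
Lemma spost_U_upto v : sowner v <> Refuter ->
  exists n, spost v `&` U = spost v `&` U_upto n.
Proof.
move=> ov; have [] := @finite_set_sub_nondecreasing _ (spost v `&` U)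
  (fun i => U_upto i) _ U_upto_nondecreasing.
- exact: finite_setIl (finite_spost ov).
- by rewrite U_eq_bigcup_upto => x [].
move=> n h; exists n; apply/seteqP; split=> x [px Ux]; split=> //.
  exact: h.
by rewrite U_eq_bigcup_upto; exists n.
Qed.

Lemma U_verifier v : sowner v = Verifier -> spost v `<=` U -> U v.
Proof.
move=> ov pU; have [n e] : exists n, spost v `&` U = spost v `&` U_upto n.
  by apply: spost_U_upto; rewrite ov.
exists n.+1 => //=; rewrite /U_next /= ov => v' pv'.
by have : (spost v `&` U) v' by [split=> //; exact: pU]; rewrite e => -[].
Qed.

Lemma U_probabilistic v : sowner v = Probabilistic ->
  ~ eq_solvable v (spost v `&` U) -> U v.
Proof.
move=> ov; have [|n ->] := @spost_U_upto v; first by rewrite ov.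
by move=> h; exists n.+1 => //=; rewrite /U_next /= ov.
Qed.

(** The system only excludes successors lying in [U], but a pair charged by a coupling is in both
    supports and hence is a successor. *)
Lemma not_U_SP_coupling s s' mu mu' (H : prob_vertex_cond A A' s s' mu mu') :
  ~ U (SP H) -> exists w, couplings mu mu' w /\
    forall t t', 0 < w (t, t') -> ~ U (SR t t').
Proof.
move=> nU.
have [x /eq_solution_coupling[w [cw wU]]] :
    eq_solvable (SP H) (spost (SP H) `&` U).
  by apply: contrapT => h; apply: nU; exact: U_probabilistic.
exists w; split=> // t t' w0 Ut; apply: (wU t t' w0); split=> //.
by left; exact: (coupling_supp cw w0).
Qed.

End Attractor.

(** * Pure memoryless strategies and finite paths *)

Section PureStrategies.
Context (R : realType) (G : game_graph R) (o : owner_kind).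
Context (f : gvertex G -> gvertex G).
Hypothesis f_edge : forall v, gowner v = o -> gedge v (f v).

Definition pure_move (h : seq (gvertex G)) (v v' : gvertex G) : R :=
  (v' == f v)%:R.

Lemma pure_move_gt0 h v v' : 0 < pure_move h v v' -> v' = f v.
Proof. by rewrite /pure_move; case: eqP => //; rewrite ltxx. Qed.

Lemma pure_move_ddist h v : gowner v = o -> is_ddist (pure_move h v).
Proof. by move=> _; exact: is_ddist_indicator. Qed.

Lemma pure_move_post h v v' :
  gowner v = o -> 0 < pure_move h v v' -> gedge v v'.
Proof. by move=> ov /pure_move_gt0 ->; exact: f_edge. Qed.

Definition pure_strategy : strategy G o :=
  Strategy pure_move_ddist pure_move_post.

End PureStrategies.

Section FinitePaths.
Context (R : realType) (G : game_graph R).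
Context (piR : strategy G Refuter) (piV : strategy G Verifier).
Local Notation V := (gvertex G).

Fixpoint positive_path (h : seq V) (v : V) (p : seq V) : Prop :=
  if p is x :: p' then
    0 < step piR piV h v x /\ positive_path (rcons h v) x p'
  else True.

(* The path is continued by staying forever in the absorbing vertex [z]. *)
Lemma positive_path_play (z v : V) (h p : seq V) :
  (forall h', 0 < step piR piV h' z z) ->
  positive_path h v p -> last v p = z ->
  let om := nth z (v :: p) in
  forall i, 0 < step piR piV (h ++ mkseq om i) (om i) (om i.+1).
Proof.
move=> zz; elim: p h v => [|x p IH] h v /=.
  move=> _ -> [|i] /=; first by rewrite cats0.
  by rewrite !nth_nil.
move=> [vx /IH{}IH] lz [|i] /=; first by rewrite cats0.
have := IH lz i; rewrite cat_rcons.
congr (0 < step piR piV (h ++ _) _ _).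
by rewrite /mkseq -[i.+1]add1n iotaD /= (iotaDl 1 0) -map_comp.
Qed.

End FinitePaths.

(** * Projection of the masking game onto the symbolic graph *)

Section MaskingGame.
Context (R : realType) (S S' Act Flt : finType).
Context (A : PTS R S Act) (A' : PTS R S' (Act + Flt)%type).
Local Notation G := (masking_game A A').
Local Notation mv := (mvertex A A').
Local Notation SR := (@SR R S S' Act Flt A A').
Local Notation MErr := (@MErr R S S' Act Flt A A').
Local Notation U := (@U R S S' Act Flt A A').
Implicit Types (v : mv).

Definition symb (v : mv) : svertex A A' :=
  match v with
  | Defs.MErr => SErr A A'
  | MR s s' => SR s s'
  | MV1 s a s' mu H => SV1 A' s' H
  | MV2 s a s' mu' H => SV2 A s H
  | MP s s' mu mu' w cw H => SP H
  end.

Lemma sowner_symb v : sowner (symb v) = mowner v.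
Proof. by case: v. Qed.

Lemma medge0_MP v s s' mu mu' (H : prob_vertex_cond A A' s s' mu mu') w
    (cw : couplings mu mu' w) :
  mowner v = Verifier -> sedge0 (symb v) (SP H) -> medge0 v (MP cw H).
Proof.
case: v => //= [s1 a s1' mu1 H1 _ [? ? ? ?]|s1 [a|f] s1' mu1' H1 _ [? ? ? ?]];
  by subst.
Qed.

(** Entering a probabilistic vertex requires a coupling, and one always exists. So a Verifier vertex
    blocked in the game is also blocked symbolically. *)
Lemma medge0_lift v sv : mowner v <> Probabilistic -> sedge0 (symb v) sv ->
  exists2 v1, symb v1 = sv & medge0 v v1.
Proof.
case: v => //= [s s'|s a s' mu H|s a s' mu' H] _.
- case: sv => //= [s1 a s1' mu H [? ? tr]|s1 a s1' mu' H [? ? tr]].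
    by exists (MV1 A' s1' H).
  by exists (MV2 A s1 H).
- case: sv => // s1 s1' mu1 mu1' H1 e.
  have [w cw] := coupling_exists mu1 mu1'.
  by exists (MP cw H1) => //; exact: (@medge0_MP (MV1 A' s' H)).
- case: sv => [|t t'|t b t' nu K|t b t' nu' K|s1 s1' mu1 mu1' H1] e;
    try by case: a H e.
  have [w cw] := coupling_exists mu1 mu1'.
  by exists (MP cw H1) => //; exact: (@medge0_MP (MV2 A s H)).
Qed.

Lemma medge0_symb v v' : mowner v <> Probabilistic ->
  medge0 v v' -> sedge0 (symb v) (symb v').
Proof.
case: v => //= [s s'|s a s' mu H|s a s' mu' H] _.
- by case: v'.
- by case: v' => //= s1 s1' mu1 mu1' w cw H1 [].
- by case: v' => [|||| s1 s1' mu1 mu1' w cw H1]; case: a H => [a|f] H //= [].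
Qed.

Lemma medge_symb v v' : mowner v <> Probabilistic ->
  medge v v' -> sedge (symb v) (symb v').
Proof.
move=> ov [/(medge0_symb ov) e|[-> [->|[oV nex]]]]; first by left.
  by right; split=> //; left.
(* For an error edge, a symbolic successor would lift to a successor in the game. *)
right; split=> //; right; rewrite sowner_symb; split=> // -[sv].
by move=> /(medge0_lift ov)[v1 _ e]; apply: nex; exists v1.
Qed.

Lemma medge_lift v sv : mowner v = Refuter -> sedge (symb v) sv ->
  exists2 v1, symb v1 = sv & medge v v1.
Proof.
move=> ov [/medge0_lift[|v1 <- e]|[-> [e|[]]]].
- by rewrite ov.
- by exists v1 => //; left.
- by case: v ov e => // _ _; exists MErr => //; right; split=> //; left.
- by rewrite sowner_symb ov.
Qed.

Lemma medge_verifier v : mowner v = Verifier -> exists v', medge v v'.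
Proof.
move=> ov; have [[v1 e]|nex] := pselect (exists v1, medge0 v v1).
  by exists v1; left.
by exists MErr; right; split=> //; right.
Qed.

Lemma medge_Err v' : medge MErr v' -> v' = MErr.
Proof. by case=> [|[]]. Qed.

(** This gives even randomized Refuter moves finite support; a Verifier vertex may have uncountably
    many successors, one for each coupling. *)
Lemma finite_medge_refuter v : mowner v = Refuter ->
  finite_set [set v' | medge v v'].
Proof.
case: v => //= [|s s'] _.
  by apply: (sub_finite_set _ (finite_set1 MErr)) => v' /medge_Err.
pose mk1 (t : S * Act * fdist R S) : mv :=
  match pselect (trans A t.1.1 t.1.2 t.2) with
  | left H => MV1 A' s' H
  | right _ => MErr
  end.
pose mk2 (t : S' * (Act + Flt) * fdist R S') : mv :=
  match pselect (trans' A' t.1.1 t.1.2 t.2) with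
  | left H => MV2 A s H
  | right _ => MErr
  end.
apply: (@sub_finite_set _ _ (mk1 @` pts_trans A `|` mk2 @` pts_trans A')).
  move=> v' [|[_ [|[]]] //].
  case: v' => //= [s1 a s1' mu H [? ? tr]|s1 a s1' mu' H [? ? tr]]; subst.
    left; exists (s, a, mu) => //; rewrite /mk1; case: pselect => //= H'.
    by rewrite (Prop_irrelevance H' H).
  right; exists (s', a, mu') => //; rewrite /mk2; case: pselect => //= H'.
  by rewrite (Prop_irrelevance H' H).
by rewrite finite_setU; split; apply: finite_image; exact: pts_finite.
Qed.

(** * The winning strategy of the Verifier outside [U] *)

(** The symbolic vertex forgets [w], and its being outside [U] only says that some coupling avoids
    [U]; at [MP] the condition must therefore bear on [w] itself. *)
Definition safe (v : mv) : Prop :=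
  match v with
  | MP _ _ _ _ w _ _ => forall t t', 0 < w (t, t') -> ~ U (SR t t')
  | _ => ~ U (symb v)
  end.

Lemma safe_not_err v : safe v -> v <> MErr.
Proof. by move=> sv e; rewrite e in sv; apply: sv; exists 0%N. Qed.

Lemma safe_refuter v v' : mowner v = Refuter -> safe v -> medge v v' -> safe v'.
Proof.
move=> ov sv e; have nU : ~ U (symb v) by case: v ov sv {e}.
have nU' : ~ U (symb v').
  move=> Uv'; apply: nU; apply: U_refuter Uv'; first by rewrite sowner_symb.
  by apply: medge_symb e; rewrite ov.
case: v' e nU' => // s s' mu mu' w cw H.
by case: v ov {sv nU} => // [|t t'] _ [] // [].
Qed.

Lemma safe_verifier v : mowner v = Verifier -> safe v ->
  exists2 v', medge v v' & safe v'.
Proof.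
move=> ov sv; have nU : ~ U (symb v) by case: v ov sv.
have [sv' e nU'] : exists2 sv', sedge (symb v) sv' & ~ U sv'.
  apply: contrapT => nex; apply: nU; apply: U_verifier.
    by rewrite sowner_symb.
  by move=> sv' e; apply: contrapT => nU'; apply: nex; exists sv'.
case: e => [e|[e _]]; last by exfalso; apply: nU'; rewrite e; exists 0%N.
have [s [s' [mu [mu' [H eH]]]]] : exists s s' mu mu' H,
    sv' = @SP R S S' Act Flt A A' s s' mu mu' H.
  clear sv nU; case: v ov e => //= [s a s' mu H|s a s' mu' H] _.
    by case: sv' nU' => //= s1 s1' mu1 mu1' H1 _ _; exists s1, s1', mu1, mu1', H1.
  by case: a H => [a|f] H; case: sv' nU' => //= s1 s1' mu1 mu1' H1 _ _;
    exists s1, s1', mu1, mu1', H1.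
rewrite eH in nU' e; have [w [cw wU]] := not_U_SP_coupling nU'.
by exists (MP cw H) => //; left; apply: medge0_MP.
Qed.

(** The strategy is given through its function [f], because the almost-sure case relies on its being
    pure. *)
Lemma verifier_sure_winning : ~ U (sinit A A') ->
  exists (f : mv -> mv) (hf : forall v, mowner v = Verifier -> medge v (f v)),
    sure_winning (@pure_strategy R G Verifier f hf) (never_err A A').
Proof.
move=> nU.
(* The move must be legal at every Verifier vertex, but preserves safety only at safe ones;
   elsewhere [v] is a dummy choice. *)
have ex v : exists v', mowner v = Verifier ->
    medge v v' /\ (safe v -> safe v').
  have [ov|nov] := pselect (mowner v = Verifier); last by exists v.
  have [sv|nsv] := pselect (safe v).
    by have [v' e sv'] := safe_verifier ov sv; exists v'.
  by have [v' e] := medge_verifier ov; exists v'.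
have [f fP] := choice ex.
have hf v : mowner v = Verifier -> medge v (f v) by move=> /fP[].
exists f, hf => piR om [om0 omS] n; apply: safe_not_err.
elim: n => [|n IH]; first by rewrite om0.
have := omS n; rewrite /step /=.
case ov : (mowner (om n)) => st0.
- exact: (safe_refuter ov IH (st_post (s := piR) ov st0)).
- have -> : om n.+1 = f (om n) by exact: pure_move_gt0 st0.
  exact: (fP _ ov).2.
- case: (om n) ov IH st0 => // s s' mu mu' w cw H _ sw.
  by case: (om n.+1) => //=; rewrite ?ltxx // => t t' /sw.
Qed.

(** Finiteness comes from the finitely many edges at Refuter vertices, the single move at Verifier
    vertices, and the finite set of pairs of states at probabilistic ones. *)
Lemma pure_step_finite_ddist (f : mv -> mv)
    (hf : forall v, mowner v = Verifier -> medge v (f v))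
    (piR : strategy G Refuter) h v :
  let K := step piR (@pure_strategy R G Verifier f hf) h v in
  (forall x, 0 <= K x) /\ exists s, finite_ddist (G := G) K s.
Proof.
rewrite /step /=; case ov : (mowner v).
- have [K0 K1] := @st_ddist _ _ _ piR h v ov; split=> //.
  have /finite_seqP[s sE] := finite_medge_refuter ov.
  have Ks x : x \notin undup s -> piR h v x = 0.
    rewrite mem_undup => xs; apply/eqP; rewrite eq_le K0 andbT leNgt.
    apply/negP => /(st_post (s := piR) ov) e; move/negP: xs; apply.
    by have : [set v' | medge v v'] x by []; rewrite sE.
  exists (undup s); split=> //; first exact: undup_uniq.
  move: K1; rewrite (esum_finite_support K0 (undup_uniq s) Ks).
  by move=> [].
- split=> [x|]; first exact: ler0n.
  exists [:: f v]; split=> // [x|].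
    by rewrite inE /pure_move => /negbTE ->.
  by rewrite big_seq1 /pure_move eqxx.
- case: v ov => // s s' mu mu' w cw H _.
  have e0 x : (x \notin [seq MR A A' t.1 t.2 | t <- enum {: S * S'}]) ->
      mdelta (MP cw H) x = 0.
    case: x => //= t t' /negP xs; exfalso; apply: xs.
    by apply/mapP; exists (t, t'); rewrite ?mem_enum.
  split; first by case=> //= t t'; exact: Defs.pmf_ge0.
  exists [seq MR A A' t.1 t.2 | t <- enum {: S * S'}]; split=> //.
    by rewrite map_inj_uniq ?enum_uniq // => -[t t'] [u u'] [-> ->].
  rewrite big_map big_enum /= -(Defs.pmf_sum1 w).
  by apply: eq_bigr => -[].
Qed.

Lemma sure_almost_sure_winning (f : mv -> mv)
    (hf : forall v, mowner v = Verifier -> medge v (f v)) Phi :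
  sure_winning (@pure_strategy R G Verifier f hf) Phi ->
  almost_sure_winning (@pure_strategy R G Verifier f hf) Phi.
Proof.
move=> sw piR.
have [h v x|h v|P [lawP outP]] :=
    @play_law_exists R G piR (@pure_strategy R G Verifier f hf).
- by have [K0 _] := pure_step_finite_ddist hf piR h v; exact: K0.
- by have [_] := pure_step_finite_ddist hf piR h v.
- by exists P; split=> //; apply: outP; exact: sw.
Qed.

(** * The spoiling strategy of the Refuter inside [U] *)

(* A single move works for all ranks at once: choose it at the least rank. *)
Lemma U_refuter_move v : mowner v = Refuter ->
  exists v', medge v v' /\
    forall i, U_upto i.+1 (symb v) -> U_upto i (symb v').
Proof.
case: v => // [|s s'] _.
  exists MErr; split; first by right; split=> //; left.
  by move=> i _; apply: (U_upto_nondecreasing (leq0n i)).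
have [[i0 Ui0]|nex] := pselect (exists i, U_upto i.+1 (SR s s')); last first.
  have [a [mu tr]] := pts_total A s.
  exists (MV1 A' s' tr); split; first by left.
  by move=> i Ui; exfalso; apply: nex; exists i.
have exb : exists i, `[< U_upto i.+1 (SR s s') >] by exists i0; apply/asboolP.
case: (ex_minnP exb) => m /asboolP Um minm.
(* By minimality of [m] the vertex is new at stage [m.+1], so it entered through [U_next]. *)
have [sv [e Usv]] : (spost (SR s s') `&` U_upto m) !=set0.
  case: Um => // Um; case: m Um minm => // m Um minm.
  by have := minm m (introT (asboolP _) Um); rewrite ltnn.
have [|v' e' ev'] := @medge_lift (MR A A' s s') sv _ e; first by [].
exists v'; split=> // i /(introT (asboolP _))/minm mi.
by rewrite e'; apply: (U_upto_nondecreasing mi).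
Qed.

(** Induction on the stage, for an arbitrary history, since the Verifier's moves depend on it and it
    grows along the path. *)
Lemma refuter_path (f : mv -> mv)
    (hf : forall v, mowner v = Refuter -> medge v (f v))
    (piV : strategy G Verifier) :
  (forall v i, mowner v = Refuter ->
    U_upto i.+1 (symb v) -> U_upto i (symb (f v))) ->
  forall i v h, U_upto i (symb v) ->
  exists p, positive_path (@pure_strategy R G Refuter f hf) piV h v p /\
            last v p = MErr.
Proof.
move=> fU; elim=> [|i IH] v h; first by case: v => // _; exists [::].
have cons v' : 0 < step (@pure_strategy R G Refuter f hf) piV h v v' ->
    U_upto i (symb v') -> exists p,
    positive_path (@pure_strategy R G Refuter f hf) piV h v p /\
    last v p = MErr.
  by move=> st0 /(IH v' (rcons h v))[p [pp lp]]; exists (v' :: p).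
move=> /[dup] Uv [/IH //|]; rewrite /U_next /= sowner_symb.
case ov : (mowner v) => Un.
- apply: (cons (f v)); last exact: fU.
  by rewrite /step /= ov /= /pure_move eqxx.
- have [v' st0] := is_ddist_pos (@st_ddist _ _ _ piV h v ov).
  apply: (cons v'); first by rewrite /step /= ov.
  by apply: Un; apply: medge_symb (st_post (s := piV) ov st0); rewrite ov.
- case: v ov Un Uv cons => // s s' mu mu' w cw H _ /= nsol _ cons.
  have [t [t' [w0 [_ Ut]]]] : exists t t', 0 < w (t, t') /\
      (spost (SP H) `&` U_upto i) (SR t t').
    (* If [w] charged no such pair, [w] itself would solve the system. *)
    apply: contrapT => nex; apply: nsol; exists (fun t t' => w (t, t')).
    apply: coupling_eq_solution => // t t' w0 Ut.
    by apply: nex; exists t, t'.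
  exact: (cons (MR A A' t t')).
Qed.

Lemma refuter_play_err (piV : strategy G Verifier) : U (sinit A A') ->
  exists (piR : strategy G Refuter) om n, outcome piR piV om /\ om n = MErr.
Proof.
rewrite U_eq_bigcup_upto => -[i _ Ui].
have ex v : exists v', mowner v = Refuter -> medge v v' /\
    forall i, U_upto i.+1 (symb v) -> U_upto i (symb v').
  have [/U_refuter_move[v' ?]|?] := pselect (mowner v = Refuter).
    by exists v'.
  by exists v.
have [f fP] := choice ex.
have hf v : mowner v = Refuter -> medge v (f v) by move=> /fP[].
have fU v j : mowner v = Refuter ->
    U_upto j.+1 (symb v) -> U_upto j (symb (f v)).
  by move=> /fP[_ h]; exact: h.
pose v0 := MR A A' (pts_init A) (pts_init A').
have [p [pp lp]] := refuter_path hf piV fU (v := v0) [::] Ui.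
have ErrErr h : 0 < step (@pure_strategy R G Refuter f hf) piV h MErr MErr.
  by rewrite /step /= /pure_move (medge_Err (hf MErr erefl)) eqxx.
(* The default value of [nth] prolongs the path by the loop at [MErr]; its last vertex has index
   [size p]. *)
exists (@pure_strategy R G Refuter f hf), (nth MErr (v0 :: p)), (size p).
split; last by rewrite nth_last.
by split=> // j; exact: (positive_path_play ErrErr pp lp).
Qed.

End MaskingGame.

(** * Measurability and probability of events on plays *)

Section PlayEvents.
Context (R : realType) (G : game_graph R).

Lemma measurable_coordinate (n : nat) (B : set (gvertex G)) :
  measurable ([set om | B (om n)] : set (playT G)).
Proof. by apply: sub_sigma_algebra; exists n, B. Qed.

Lemma measurable_cone (om : play G) (n : nat) :
  measurable (cone om n : set (playT G)).
Proof.
rewrite (_ : cone om n =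
             \bigcap_(i in [set i | (i <= n)%N]) [set om' | om' i = om i]).
  apply: bigcap_measurable => [|i _]; first by exists 0%N.
  exact: (measurable_coordinate i [set om i]).
by apply/seteqP; split.
Qed.

Lemma play_law_cone_gt0 (piR : strategy G Refuter) (piV : strategy G Verifier)
    (P : probability (playT G) R) (om : play G) (n : nat) :
  is_play_law piR piV P -> outcome piR piV om -> (0 < P (cone om n))%E.
Proof.
move=> -> [om0 omS]; rewrite om0 eqxx mul1r lte_fin.
by apply: prodr_gt0 => i _; exact: omS.
Qed.

End PlayEvents.

(** * Winning strategies exist exactly outside [U] *)

Section Main.
Context (R : realType) (S S' Act Flt : finType).
Context (A : PTS R S Act) (A' : PTS R S' (Act + Flt)%type).

Lemma measurable_never_err :
  measurable (never_err A A' : set (playT (masking_game A A'))).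
Proof.
rewrite (_ : never_err A A' =
             \bigcap_n [set om | ~ ([set @MErr _ _ _ _ _ A A'] (om n))]).
  apply: bigcap_measurable => [|n _]; first by exists 0%N.
  exact: (@measurable_coordinate _ (masking_game A A') n
            (~` [set @MErr _ _ _ _ _ A A'])).
by apply/seteqP; split=> om h n; [move=> _; exact: h | exact: h].
Qed.

(** The cone of a play up to its visit to the error vertex has positive probability and is disjoint
    from [never_err], whose complement would have probability 0. *)
Lemma almost_sure_winning_not_U (piV : strategy (masking_game A A') Verifier) :
  almost_sure_winning piV (never_err A A') -> ~ U (sinit A A').
Proof.
move=> asw /(refuter_play_err piV)[piR [om [n [out omn]]]].
have [P [law P1]] := asw piR.
have Pc : (P (cone om n) <= P (~` (never_err A A')))%E.
  apply: le_measure; rewrite ?inE; first exact: measurable_cone.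
    by apply: measurableC; exact: measurable_never_err.
  by move=> om' /(_ n (leqnn n)) e /(_ n); rewrite e.
have := lt_le_trans (play_law_cone_gt0 n law out) Pc.
rewrite probability_setC ?P1 ?subee ?ltxx //; exact: measurable_never_err.
Qed.

Lemma sure_winning_not_U (piV : strategy (masking_game A A') Verifier) :
  sure_winning piV (never_err A A') -> ~ U (sinit A A').
Proof.
by move=> sw /(refuter_play_err piV)[piR [om [n [out]]]]; exact: (sw _ _ out).
Qed.

End Main.

Theorem theorem2 (R : realType) (S S' Act Flt : finType)
    (A : PTS R S Act) (A' : PTS R S' (Act + Flt)%type) :
  ((exists piV : strategy (masking_game A A') Verifier,
      sure_winning piV (never_err A A')) <->
   ~ U (sinit A A')) /\
  ((exists piV : strategy (masking_game A A') Verifier,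
      almost_sure_winning piV (never_err A A')) <->
   ~ U (sinit A A')).
Proof.
split; split.
- by case=> piV; exact: sure_winning_not_U.
- by move=> /verifier_sure_winning[f [hf sw]]; eexists; exact: sw.
- by case=> piV; exact: almost_sure_winning_not_U.
- move=> /verifier_sure_winning[f [hf sw]]; eexists.
  exact: sure_almost_sure_winning sw.
Qed.
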